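(* Let $q$ be a prime number and $d,\ell\in\mathbb{N}$. Let $f:\mathbb{F}_q^d\to\mathbb{F}_q^{\ell}$ be a scalar respecting function. Let $\epsilon,\kappa>0$ be parameters such that $\kappa\ge\epsilon\gg\frac{1}{q^{1/3}}$. If $f$ passes the test $\mathcal{T}$ with probability $\epsilon$, then there exists a linear function $c:\mathbb{F}_q^d\to\mathbb{F}_q^{\ell}$ such that $$\Pr_{\vec{\alpha}\sim \mathsf{var}(f,\mathcal{T})}\left[\|f(\vec{\alpha})-c(\vec{\alpha})\|\le\kappa\right]\ge\frac{\epsilon^2}{3},$$ where $\vec\alpha$ is uniform over $\mathsf{var}(f,\mathcal{T})$.
   Context: For a function $f:\mathbb{F}_q^d\to\mathbb{F}_q^{\ell}$, the linearity test $\mathcal{T}$ picks $\vec{\alpha},\vec{\beta}\in\mathbb{F}_q^d$ uniformly and independently at random, and accepts iff $f(\vec{\alpha})+f(\vec{\beta})=f(\vec{\alpha}+\vec{\beta})$. Define $S_{f,\mathcal{T}}:=\{(\vec{\alpha},\vec{\beta})\in\mathbb{F}_q^d\times\mathbb{F}_q^d: f(\vec{\alpha})+f(\vec{\beta})=f(\vec{\alpha}+\vec{\beta})\}$ and $\mathsf{var}(f,\mathcal{T}):=\{\vec{\alpha}\in\mathbb{F}_q^d:\exists\vec{\beta}\in\mathbb{F}_q^d \text{ with } (\vec{\alpha},\vec{\beta})\in S_{f,\mathcal{T}}\}$. A function $c$ is linear if $c(\vec\alpha)+c(\vec\beta)=c(\vec\alpha+\vec\beta)$ for all $\vec\alpha,\vec\beta$;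 $f$ is scalar respecting if $f(\gamma\vec{\alpha})=\gamma f(\vec{\alpha})$ for all $\vec\alpha\in\mathbb{F}_q^d$, $\gamma\in\mathbb{F}_q$. For $x,y\in\mathbb{F}_q^\ell$, $\|x-y\|$ denotes the relative Hamming distance, i.e. the fraction of coordinates $i\in[\ell]$ with $x_i\ne y_i$. The notation $\epsilon\gg q^{-1/3}$ means $\epsilon$ is sufficiently large compared to $q^{-1/3}$. *)

(* Defs.v *)
From HB Require Import structures.
From mathcomp Require Import all_boot all_order all_algebra.
From mathcomp Require Import reals exp.

Set Implicit Arguments.
Unset Strict Implicit.
Unset Printing Implicit Defensive.

Import Order.TTheory GRing.Theory Num.Theory.

Local Open Scope ring_scope.

(* Pr_{x ~ A}[P x] for x uniform over A; equal to 0 when A is empty. *)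
Definition unif_pr (R : realType) (T : finType) (A : {set T}) (P : pred T) : R :=
  #|[set x in A | P x]|%:R / #|A|%:R.

(* Equal to 0 when l = 0. *)
Definition rel_hamming (R : realType) (F : finFieldType) (l : nat)
    (x y : 'rV[F]_l) : R :=
  unif_pr R [set: 'I_l] (fun i => x ord0 i != y ord0 i).

Section LinearityTest.

Variables (F : finFieldType) (d l : nat).
Implicit Types f c : 'rV[F]_d -> 'rV[F]_l.

Definition test_accepts f (ab : 'rV[F]_d * 'rV[F]_d) : bool :=
  f ab.1 + f ab.2 == f (ab.1 + ab.2).

Definition test_accept_set f : {set 'rV[F]_d * 'rV[F]_d} :=
  [set ab | test_accepts f ab].

Definition test_var f : {set 'rV[F]_d} :=
  [set a | [exists b, (a, b) \in test_accept_set f]].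

Definition test_pass_pr (R : realType) f : R :=
  unif_pr R [set: 'rV[F]_d * 'rV[F]_d] (test_accepts f).

Definition linear_function c : Prop :=
  forall a b : 'rV[F]_d, c a + c b = c (a + b).

Definition scalar_respecting f : Prop :=
  forall (a : 'rV[F]_d) (g : F), f (g *: a) = g *: f a.

End LinearityTest.

(* Main.v *)
(** Since [f 0 = 0], every point lies in [test_var f].  Write [n] for the number
    of points.  By Cauchy-Schwarz, the four-term test
    [f a + f b = f c + f (a + b - c)] accepts with probability at least [eps^2].

    Fix a coordinate of [f], a scalar function, and let [w a] be the linear form
    that agrees with it at [a] and, among those, agrees with it at most points.
    Scalar respect makes the Fourier coefficients of the coordinate, and of its
    restrictions to the classes of [w], real and affine in the number of
    agreements; hence the number of accepted [(a, b, c)] with [w a <> w b] is,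
    up to [n^3 / q], proportional to
    [\sum_s J s ^ 2 * (J s ^ 2 - \sum_r J_r s ^ 2)], where [J] and [J_r] are the
    normalised coefficients of the coordinate and of its restriction to
    [w = r].  Keeping only [r = s], each difference is [O(n^2 q)]: either [J s ^ 2]
    itself is, or few forms are at least as heavy as [s] (Johnson bound), and
    each of them meets [s] on a hyperplane only.  By Parseval, accepted triples with [w a <> w b] have
    density [O(1/q)].

    By Markov over the coordinates, for all but [O(1/(q kappa))], which is much
    less than [eps^2], of the triples, if the test accepts then [w a = w b] on
    all but a [kappa] fraction of the coordinates.  Fixing a good [a], the forms
    [w a] of the coordinates make up the linear function. *)

Require Import Defs.
From HB Require Import structures.
From mathcomp Require Import all_boot all_order all_algebra.
From mathcomp Require Import algC cyclotomic reals exp.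
From mathcomp Require Import zify ring lra.

Set Implicit Arguments.
Unset Strict Implicit.
Unset Printing Implicit Defensive.

Import Order.TTheory GRing.Theory Num.Theory.

Local Open Scope ring_scope.

(** * Linear forms on [F^d], given by row vectors *)

Section Dot.

Variables (F : finFieldType) (d : nat).
Implicit Types s a : 'rV[F]_d.

Definition dot s a : F := \sum_j s ord0 j * a ord0 j.

Lemma dotDl s s' a : dot (s + s') a = dot s a + dot s' a.
Proof. by rewrite /dot -big_split; apply: eq_bigr => j _; rewrite mxE mulrDl. Qed.

Lemma dotBl s s' a : dot (s - s') a = dot s a - dot s' a.
Proof. by rewrite /dot -sumrB; apply: eq_bigr => j _; rewrite !mxE mulrBl. Qed.

Lemma dotDr s a a' : dot s (a + a') = dot s a + dot s a'.
Proof. by rewrite /dot -big_split; apply: eq_bigr => j _; rewrite mxE mulrDr. Qed.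

Lemma dotBr s a a' : dot s (a - a') = dot s a - dot s a'.
Proof. by rewrite /dot -sumrB; apply: eq_bigr => j _; rewrite !mxE mulrBr. Qed.

Lemma dotZr s t a : dot s (t *: a) = t * dot s a.
Proof. by rewrite /dot mulr_sumr; apply: eq_bigr => j _; rewrite mxE mulrCA. Qed.

Lemma dotZl s t a : dot (t *: s) a = t * dot s a.
Proof. by rewrite /dot mulr_sumr; apply: eq_bigr => j _; rewrite mxE mulrA. Qed.

Lemma dot0r s : dot s 0 = 0.
Proof. by rewrite -(scale0r s) dotZr mul0r. Qed.

Lemma dot_surj a (t : F) : a != 0 -> exists s, dot s a = t.
Proof.
move=> /rV0Pn[j aj]; exists ((t / a ord0 j) *: delta_mx ord0 j).
rewrite dotZl /dot (bigD1 j) //= big1 => [|i ij].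
  by rewrite !mxE !eqxx mul1r addr0 divfK.
by rewrite mxE eqxx (negPf ij) mul0r.
Qed.

Lemma dotC s a : dot s a = dot a s.
Proof. by apply: eq_bigr => j _; rewrite mulrC. Qed.

(** The [#|F|] fibres of [dot s] are translates of its kernel. *)
Lemma card_hyperplane s : s != 0 ->
  (#|F| * #|[set a | dot s a == 0%R]|)%N = #|{: 'rV[F]_d}|.
Proof.
move=> s0.
have fib (t : F) : #|[set a | dot s a == t]| = #|[set a | dot s a == 0]|.
  have [b bt] := dot_surj t s0; rewrite dotC in bt.
  rewrite -(card_preimset [set a | dot s a == t] (addIr b)).
  by apply: eq_card => a; rewrite !inE dotDr bt -[eqbRHS]add0r (inj_eq (addIr t)).
rewrite -[RHS]sum1_card (partition_big (dot s) predT) //= -sum_nat_const.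
by apply: eq_bigr => t _; rewrite -(fib t) -sum1dep_card.
Qed.

End Dot.

(** * Fourier analysis of a scalar-respecting function *)

Section Character.

Variables (F : finFieldType) (d : nat) (chi : F -> algC).
Hypothesis chi0 : chi 0 = 1.
Hypothesis chiD : forall x y, chi (x + y) = chi x * chi y.
Hypothesis chi_nontriv : exists x, chi x != 1.

Local Notation V := 'rV[F]_d.
Local Notation q := #|F|.
Local Notation n := #|{: V}|.

Lemma sum_char_dot (a : V) : \sum_s chi (dot s a) = n%:R * (a == 0)%:R.
Proof.
have [->|a0] := eqVneq a 0.
  rewrite mulr1 -sum1_card natr_sum; apply: eq_bigr => s _.
  by rewrite dot0r chi0.
(* Translating [s] by [s0] multiplies the sum by [chi x], which is not 1, so the sum vanishes. *)
have [x x1] := chi_nontriv; have [s0 s0a] := dot_surj x a0.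
rewrite mulr0; apply: contraNeq x1 => S0; apply/eqP/(mulIf S0).
rewrite mul1r mulr_sumr [RHS](reindex_inj (addrI s0)) /=.
by apply: eq_bigr => s _; rewrite dotDl s0a chiD.
Qed.

Lemma sum_char_mul (y : F) : \sum_(t | t != 0) chi (t * y) = q%:R * (y == 0)%:R - 1.
Proof.
suff <- : \sum_t chi (t * y) = q%:R * (y == 0)%:R.
  by rewrite [in RHS](bigD1 0) //= mul0r chi0 addrAC subrr add0r.
have [->|y0] := eqVneq y 0.
  rewrite mulr1 -sum1_card natr_sum; apply: eq_bigr => s _.
  by rewrite mulr0 chi0.
have [x x1] := chi_nontriv.
rewrite mulr0; apply: contraNeq x1 => S0; apply/eqP/(mulIf S0).
rewrite mul1r mulr_sumr [RHS](reindex_inj (addrI (x / y))) /=.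
by apply: eq_bigr => s _; rewrite mulrDl divfK // chiD.
Qed.

(** Averaging over all nonzero [t] turns the character into an indicator, so the sum becomes a
    weighted count of the zeros of [y]. *)
Lemma scale_invariant_char_sum (T : finType) (u : T -> algC) (y : T -> F) :
  (forall t, t != 0 -> \sum_x u x * chi (t * y x) = \sum_x u x * chi (y x)) ->
  (q%:R - 1) * \sum_x u x * chi (y x) = \sum_x u x * (q%:R * (y x == 0)%:R - 1).
Proof.
move=> inv; have -> : q%:R - 1 = \sum_(t : F | t != 0) 1 :> algC.
  rewrite sumr_const; have := max_card (pred1 (0 : F)).
  have -> : #|[pred t : F | t != 0]| = (q - 1)%N.
    by rewrite -(cardC (pred1 (0 : F))) card1 addKn; apply: eq_card.
  by rewrite card1 => ?; rewrite natrB.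
rewrite mulr_suml; under eq_bigr => t t0 do rewrite mul1r -(inv t t0).
rewrite exchange_big /=; apply: eq_bigr => x _.
by rewrite -mulr_sumr sum_char_mul.
Qed.

Variables (f : V -> F).
Hypothesis f_scale : forall (t : F) (a : V), f (t *: a) = t * f a.

Definition scale_invariant (h : V -> int) :=
  forall t a, t != 0 -> h (t *: a) = h a.

(** The unnormalised Fourier coefficient at [s] of [chi \o f] weighted by [h]. The weights of
    interest are 1 and the indicators of the classes of [w]. *)
Definition char_transform (h : V -> int) (s : V) : algC :=
  \sum_a (h a)%:~R * chi (f a - dot s a).

Lemma char_transform_scale h s t : scale_invariant h -> t != 0 ->
  \sum_a (h a)%:~R * chi (t * (f a - dot s a)) = char_transform h s.
Proof.
move=> hh t0; rewrite /char_transform [RHS](reindex_inj (scalerI t0)) /=.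
by apply: eq_bigr => a _; rewrite hh // f_scale dotZr mulrBr.
Qed.

(** Scaling by -1 is why the coefficients are real; the identities below then need no
    conjugation. *)
Lemma char_transformN h s : scale_invariant h ->
  char_transform h s = \sum_a (h a)%:~R * chi (dot s a - f a).
Proof.
move=> hh; have N1 : (-1 : F) != 0 by rewrite oppr_eq0 oner_eq0.
rewrite -(char_transform_scale s hh N1).
by apply: eq_bigr => a _; rewrite mulN1r opprB.
Qed.

(** Parseval: orthogonality leaves only the diagonal [a = b]. *)
Lemma sum_char_transform_sqr h k : scale_invariant k ->
  \sum_s char_transform h s * char_transform k s =
  n%:R * \sum_a (h a)%:~R * (k a)%:~R.
Proof.
move=> hk; under eq_bigr => s _ do rewrite (char_transformN _ hk) big_distrlr.
rewrite exchange_big /= mulr_sumr; apply: eq_bigr => a _.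
rewrite exchange_big /= (bigD1 a) //= [X in _ + X]big1 => [|b ba].
  rewrite addr0 (eq_bigr (fun _ => (h a)%:~R * (k a)%:~R)) => [|s _].
    by rewrite sumr_const mulr_natl.
  by rewrite mulrACA -chiD subrKA subrr chi0 mulr1.
rewrite (eq_bigr (fun s =>
    (h a)%:~R * (k b)%:~R * chi (f a - f b) * chi (dot s (b - a)))).
  by rewrite -mulr_sumr sum_char_dot subr_eq0 (negPf ba) !mulr0.
move=> s _; rewrite mulrACA -[RHS]mulrA -!chiD dotBr; congr (_ * chi _); ring.
Qed.

(** The two unweighted factors are expanded with the opposite sign, so summing over [s] keeps
    exactly the quadruples with [e = a + b - c]. *)
Lemma sum_char_transform_quad h k :
  scale_invariant h -> scale_invariant k ->
  \sum_s char_transform h s * char_transform k s * char_transform (fun=> 1) s ^+ 2 =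
  n%:R * \sum_a \sum_b \sum_c (h a)%:~R * (k b)%:~R *
           chi (f a + f b - f c - f (a + b - c)).
Proof.
move=> hh hk.
pose G a b c e : algC := (h a)%:~R * (k b)%:~R * chi (f a + f b - f c - f e).
transitivity (\sum_s \sum_a \sum_b \sum_c \sum_e
    G a b c e * chi (dot s (e - (a + b - c)))).
  apply: eq_bigr => s _; rewrite expr2 (@char_transformN (fun=> 1)) //.
  rewrite /char_transform 2!big_distrlr /=.
  rewrite mulr_suml; apply: eq_bigr => a _.
  rewrite mulr_suml; apply: eq_bigr => b _.
  rewrite mulr_sumr; apply: eq_bigr => c _.
  rewrite mulr_sumr; apply: eq_bigr => e _.
  have E : chi (f a + f b - f c - f e) * chi (dot s (e - (a + b - c))) =
      chi (f a - dot s a) * chi (f b - dot s b) *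
      (chi (dot s c - f c) * chi (dot s e - f e)).
    by rewrite -!chiD !dotBr dotDr; congr chi; ring.
  by rewrite /G -[RHS]mulrA E; ring.
rewrite exchange_big mulr_sumr; apply: eq_bigr => a _.
rewrite exchange_big mulr_sumr; apply: eq_bigr => b _.
rewrite exchange_big mulr_sumr; apply: eq_bigr => c _.
rewrite exchange_big /= (bigD1 (a + b - c)) //= [X in _ + X]big1 => [|e ec].
  by rewrite -mulr_sumr sum_char_dot subrr eqxx mulr1 addr0 mulrC.
by rewrite -mulr_sumr sum_char_dot subr_eq0 (negPf ec) !mulr0.
Qed.

(** For invariant [h] this is [q - 1] times the Fourier coefficient. Being an integer, it moves all
    later estimates out of [algC]. *)
Definition agreement_excess (h : V -> int) (s : V) : int :=
  \sum_a h a * (q%:Z * (f a == dot s a) - 1).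

Lemma char_transformE h s : scale_invariant h ->
  (q%:R - 1) * char_transform h s = (agreement_excess h s)%:~R.
Proof.
move=> hh; rewrite scale_invariant_char_sum => [|t t0]; last first.
  exact: char_transform_scale.
rewrite raddf_sum /=; apply: eq_bigr => a _.
by rewrite rmorphM rmorphB rmorphM /= subr_eq0.
Qed.

Lemma sum_agreement_excess_sqr :
  \sum_s agreement_excess (fun=> 1) s ^+ 2 = (q%:Z - 1) ^+ 2 * n%:Z ^+ 2.
Proof.
apply/eqP; rewrite -(eqr_int algC); apply/eqP.
rewrite raddf_sum /= rmorphM !rmorphXn rmorphB /=.
under eq_bigr => s _ do rewrite rmorphXn /= -char_transformE // exprMn.
rewrite -mulr_sumr; under eq_bigr => s _ do rewrite expr2.
rewrite sum_char_transform_sqr //; congr (_ * _).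
under eq_bigr => a _ do rewrite mulr1.
by rewrite sumr_const expr2.
Qed.

(** The character sum over triples is again invariant under scaling, so it also averages to a count;
    this consumes one of the four factors [q - 1]. *)
Lemma sum_agreement_excess_quad h k :
  scale_invariant h -> scale_invariant k ->
  \sum_s agreement_excess h s * agreement_excess k s *
      agreement_excess (fun=> 1) s ^+ 2 =
  (q%:Z - 1) ^+ 3 * n%:Z * \sum_a \sum_b \sum_c h a * k b *
           (q%:Z * (f a + f b - f c - f (a + b - c) == 0) - 1).
Proof.
move=> hh hk; apply/eqP; rewrite -(eqr_int algC); apply/eqP.
rewrite raddf_sum /=.
rewrite (eq_bigr (fun s => (q%:R - 1) ^+ 4 * (char_transform h s *
    char_transform k s * char_transform (fun=> 1) s ^+ 2))); last first.
  by move=> s _; rewrite 2!rmorphM rmorphXn /= -!char_transformE //; ring.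
rewrite -mulr_sumr sum_char_transform_quad //.
pose y (x : V * V * V) := f x.1.1 + f x.1.2 - f x.2 - f (x.1.1 + x.1.2 - x.2).
pose u (x : V * V * V) : algC := (h x.1.1)%:~R * (k x.1.2)%:~R.
have tripleE (K : nmodType) (G : V -> V -> V -> K) :
    \sum_a \sum_b \sum_c G a b c = \sum_(x : V * V * V) G x.1.1 x.1.2 x.2.
  by rewrite pair_bigA pair_bigA.
rewrite tripleE [in RHS]tripleE 2!rmorphM rmorphXn rmorphB /=.
have inv t : t != 0 -> \sum_x u x * chi (t * y x) = \sum_x u x * chi (y x).
  move=> t0; pose z (x : V * V * V) := (t *: x.1.1, t *: x.1.2, t *: x.2).
  have zI : injective z.
    by move=> [[a b] c] [[a' b'] c'] [] /(scalerI t0)-> /(scalerI t0)-> /(scalerI t0)->.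
  rewrite [RHS](reindex_inj zI); apply: eq_bigr => -[[a b] c] _.
  rewrite /u /y /= hh // hk // -scalerDr -scalerBr !f_scale.
  by congr (_ * chi _); ring.
transitivity ((q%:R - 1) ^+ 3 * n%:R * ((q%:R - 1) * \sum_x u x * chi (y x))).
  by rewrite /u /y; ring.
rewrite (scale_invariant_char_sum inv) raddf_sum; congr (_ * _).
apply: eq_bigr => x _; rewrite /u /y.
by rewrite /= !rmorphM rmorphB rmorphM.
Qed.

End Character.

(** Twice the gap between the two sides is [\sum_i \sum_j (x i - x j) ^+ 2]. *)
Lemma sqr_sum_le (K : realDomainType) (I : finType) (x : I -> K) :
  (\sum_i x i) ^+ 2 <= #|I|%:R * \sum_i x i ^+ 2.
Proof.
have : 0 <= \sum_i \sum_j (x i - x j) ^+ 2.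
  by apply: sumr_ge0 => i _; apply: sumr_ge0 => j _; apply: sqr_ge0.
suff -> : \sum_i \sum_j (x i - x j) ^+ 2 =
    2%:R * (#|I|%:R * \sum_i x i ^+ 2 - (\sum_i x i) ^+ 2).
  by rewrite pmulr_rge0 ?ltr0n // subr_ge0.
transitivity (\sum_i \sum_j (x i ^+ 2 + x j ^+ 2 - 2%:R * (x i * x j))).
  by apply: eq_bigr => i _; apply: eq_bigr => j _; ring.
transitivity (\sum_i (#|I|%:R * x i ^+ 2 + \sum_j x j ^+ 2 -
    2%:R * (x i * \sum_j x j))).
  apply: eq_bigr => i _; rewrite sumrB big_split /= sumr_const mulr_natl.
  by rewrite !mulr_sumr.
rewrite sumrB big_split /= sumr_const -!mulr_sumr -mulr_suml -mulr_natl.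
by ring.
Qed.

(** * Forms that agree with a scalar function at many points *)

Section HeaviestExplanation.

Variables (F : finFieldType) (d : nat) (f : 'rV[F]_d -> F).

Local Notation V := 'rV[F]_d.
Local Notation q := #|F|.
Local Notation n := #|{: V}|.

Definition agreement (s : V) : nat := #|[set a | f a == dot s a]|.

Lemma agreementE s : (agreement s)%:Z = \sum_a (f a == dot s a)%:R.
Proof.
rewrite /agreement -sum1dep_card -[LHS]natz natr_sum big_mkcond.
by apply: eq_bigr => a _; case: (_ == _).
Qed.

(** Where both forms agree with [f] they agree with each other, that is, on the hyperplane
    [dot (s - s') a = 0]. *)
Lemma card_common_agreement s s' : s != s' ->
  q%:Z * \sum_a (f a == dot s a)%:R * (f a == dot s' a)%:R <= n%:Z.
Proof.
move=> ss'; rewrite -(card_hyperplane (s := s - s')) ?subr_eq0 // PoszM.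
rewrite ler_wpM2l // -sum1dep_card -[leRHS]natz natr_sum [leRHS]big_mkcond /=.
apply: ler_sum => a _; rewrite dotBl subr_eq0.
by case: eqP => [<-|_]; rewrite ?mul0r; case: (_ == _).
Qed.

(* Cauchy-Schwarz on the multiplicities [mu], i.e. the Johnson bound. *)
Lemma card_heavy (m : nat) : 2 * n%:Z ^+ 2 <= q%:Z * m%:Z ^+ 2 ->
  #|[set s | (m <= agreement s)%N]|%:Z * m%:Z <= 2 * n%:Z.
Proof.
set L := [set s | _] => qm.
pose mu a : int := \sum_(s in L) (f a == dot s a)%:R.
pose S := \sum_a mu a.
have SE : S = \sum_(s in L) (agreement s)%:Z.
  by rewrite /S exchange_big; apply: eq_bigr => s _; rewrite agreementE.
have kmS : #|L|%:Z * m%:Z <= S.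
  rewrite SE -[#|L|%:Z]natz mulr_natl -sumr_const; apply: ler_sum => s.
  by rewrite inE lez_nat.
have CS : S ^+ 2 <= n%:Z * \sum_a mu a ^+ 2 by rewrite -[n%:Z]natz; apply: sqr_sum_le.
(* Expand over pairs in [L]: the diagonal gives [S], and every other pair at most [n / q]. *)
have mu2 : q%:Z * \sum_a mu a ^+ 2 <= q%:Z * S + #|L|%:Z ^+ 2 * n%:Z.
  have -> : \sum_a mu a ^+ 2 = \sum_(s in L) \sum_(s' in L)
      \sum_a (f a == dot s a)%:R * (f a == dot s' a)%:R.
    under eq_bigr => a _ do rewrite expr2 big_distrlr /=.
    by rewrite exchange_big; apply: eq_bigr => s _; rewrite exchange_big.
  have -> : #|L|%:Z ^+ 2 * n%:Z = \sum_(s in L) \sum_(s' in L) n%:Z.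
    by rewrite !sumr_const -mulrnA -[RHS]mulr_natr natz PoszM; ring.
  rewrite SE !mulr_sumr -big_split; apply: ler_sum => s sL.
  rewrite (bigD1 s) //= [X in _ <= _ + X](bigD1 s) //= mulrDr addrA lerD //.
    rewrite agreementE (eq_bigr (fun a => (f a == dot s a)%:R)) ?lerDl //.
    by move=> a _; case: (_ == _).
  rewrite mulr_sumr; apply: ler_sum => s' /andP[_ s's].
  by apply: card_common_agreement; rewrite eq_sym.
have q0 : 0 < q%:Z by have : 1 < q%:Z := card_finNzRing_gt1 F; lia.
have S0 : 0 <= S by rewrite SE sumr_ge0.
apply: (le_trans kmS).
(* If [S > 2 n], the hypothesis on [m] makes the off-diagonal term at most half of [q S^2]; what
   remains forces [S <= 2 n], a contradiction. *)
have [|S2] := leP S (2 * n%:Z); first by [].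
have : q%:Z * S ^+ 2 <= n%:Z * (q%:Z * S) + (#|L|%:Z * n%:Z) ^+ 2.
  apply: le_trans (_ : n%:Z * (q%:Z * S + #|L|%:Z ^+ 2 * n%:Z) <= _); last by lia.
  apply: le_trans (ler_wpM2l (ltW q0) CS) _; rewrite mulrCA.
  exact: ler_wpM2l.
have : 2 * (#|L|%:Z * n%:Z) ^+ 2 <= q%:Z * S ^+ 2.
  apply: le_trans (_ : q%:Z * (#|L|%:Z * m%:Z) ^+ 2 <= _).
    rewrite !exprMn mulrCA [leRHS]mulrCA; apply: ler_wpM2l qm; exact: sqr_ge0.
  by rewrite ler_pM2l // ler_pXn2r.
have : (2 * n%:Z) * (q%:Z * S) < S * (q%:Z * S).
  by rewrite ltr_pM2r // mulr_gt0 //; lia.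
by lia.
Qed.

Variable w : V -> V.
Hypothesis w_agree : forall a, f a = dot (w a) a.
Hypothesis w_max : forall a s, f a = dot s a -> (agreement s <= agreement (w a))%N.

(** If [f] agrees with [s] at [a] but [w a != s], then [w a] is at least as heavy as [s] and agrees
    with [f] there too. Such points are covered by the common agreement sets of [s] with the forms
    in [L]. *)
Lemma card_outweighed_agreement s :
  q%:Z * \sum_a (w a != s)%:R * (f a == dot s a)%:R <=
  #|[set s' | (agreement s <= agreement s')%N]|%:Z * n%:Z.
Proof.
set L := [set s' | _].
apply: le_trans (_ : \sum_(s' in L | s' != s)
    q%:Z * \sum_a (f a == dot s a)%:R * (f a == dot s' a)%:R <= _).
  rewrite -mulr_sumr ler_wpM2l // exchange_big; apply: ler_sum => a _ /=.
  have [ws|ws] := eqVneq (w a) s.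
    by rewrite mul0r sumr_ge0 // => s' _; rewrite mulr_ge0 ?ler0n.
  rewrite mul1r; have [fs|_] := eqVneq (f a) (dot s a); last first.
    by rewrite sumr_ge0 // => s' _; rewrite mulr_ge0 ?ler0n.
  rewrite (bigD1 (w a)) /= => [|]; last by rewrite inE w_max // ws.
  by rewrite -w_agree eqxx mul1r lerDl sumr_ge0 // => s' _; rewrite mulr_ge0 ?ler0n.
apply: le_trans (_ : \sum_(s' in L | s' != s) n%:Z <= _).
  apply: ler_sum => s' /andP[_ s's].
  by apply: card_common_agreement; rewrite eq_sym.
rewrite -[#|L|%:Z]natz mulr_natl -sumr_const big_mkcondr /=.
by apply: ler_sum => s' _; case: ifP.
Qed.

Local Notation J := (agreement_excess f).
Local Notation cls r := (fun a : V => (w a == r)%:R : int).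

Lemma agreement_excess1 s : J (fun=> 1) s = q%:Z * (agreement s)%:Z - n%:Z.
Proof.
rewrite /agreement_excess agreementE mulr_sumr.
under eq_bigr => a _ do rewrite mul1r.
rewrite sumrB; congr (_ - _); last by rewrite sumr_const natz.
by apply: eq_bigr => a _; rewrite -[X in _ * X]natz.
Qed.

Lemma agreement_excess_sqr_drop s :
  J (fun=> 1) s ^+ 2 - J (cls s) s ^+ 2 <= 4 * n%:Z ^+ 2 * q%:Z.
Proof.
pose x : int := \sum_a (w a != s)%:R * (f a == dot s a)%:R.
have JB : J (fun=> 1) s - J (cls s) s <= q%:Z * x.
  rewrite /agreement_excess -sumrB mulr_sumr; apply: ler_sum => a _.
  by case: (w a == s); case: (f a == dot s a) => /=; lia.
have x0 : 0 <= x by rewrite sumr_ge0 // => a _; rewrite mulr_ge0 ?ler0n.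
have q1 : 1 < q%:Z := card_finNzRing_gt1 F.
have outweighed := card_outweighed_agreement s; rewrite -/x in outweighed.
have n0 : 0 <= n%:Z by [].
rewrite agreement_excess1 in JB *.
set m := agreement s in outweighed JB *; set j := J (cls s) s in JB *.
have m0 : 0 <= m%:Z by [].
have [heavy|light] := leP (2 * n%:Z ^+ 2) (q%:Z * m%:Z ^+ 2).
  have km := card_heavy heavy.
  set k := #|_|%:Z in outweighed km.
  (* With [e] for this excess, [e^2 - j^2 = (e - j)(e + j)] is at most [q x * 2 e] when [j < e]; the
     sign of [e] settles the case [e <= j]. *)
  have E0 : 0 <= q%:Z * m%:Z - n%:Z.
    rewrite subr_ge0 -(ler_pXn2r (n := 2)) ?nnegrE ?mulr_ge0 // exprMn.
    nia.
  have : (q%:Z * x) * (q%:Z * m%:Z) <= 2 * n%:Z ^+ 2 * q%:Z.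
    have : (q%:Z * x) * (q%:Z * m%:Z) <= (k * n%:Z) * (q%:Z * m%:Z).
      by apply: ler_wpM2r => //; rewrite mulr_ge0 ?ler0n.
    have : (k * m%:Z) * (n%:Z * q%:Z) <= (2 * n%:Z) * (n%:Z * q%:Z).
      by apply: ler_wpM2r => //; rewrite mulr_ge0 ?ler0n.
    lia.
  move: E0 JB; set e := q%:Z * m%:Z - n%:Z => E0 JB qxm.
  have em : e <= q%:Z * m%:Z by rewrite /e; lia.
  have [ej|je] := leP e j; first by nia.
  have : (e - j) * (e + j) <= (q%:Z * x) * (2 * e) by nia.
  have : (q%:Z * x) * (2 * e) <= (q%:Z * x) * (2 * (q%:Z * m%:Z)).
    by apply: ler_wpM2l; [rewrite mulr_ge0 | lia].
  lia.
(* For light [s] nothing need be subtracted: [(q m - n)^2 <= (q m)^2 + n^2 <= 3 n^2 q]. *)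
have qm0 : 0 <= q%:Z * m%:Z by rewrite mulr_ge0 ?ler0n.
have : (q%:Z * m%:Z) ^+ 2 <= 2 * n%:Z ^+ 2 * q%:Z.
  by rewrite exprMn expr2 -mulrA mulrC ler_wpM2r // ltW.
have : n%:Z ^+ 2 <= n%:Z ^+ 2 * q%:Z by rewrite ler_peMr ?sqr_ge0 // ltW.
have : 0 <= j ^+ 2 by exact: sqr_ge0.
nia.
Qed.

End HeaviestExplanation.

(** * Accepted quadruples whose heaviest forms differ *)

Section BadQuadruples.

Variables (F : finFieldType) (d : nat) (chi : F -> algC).
Hypothesis chi0 : chi 0 = 1.
Hypothesis chiD : forall x y, chi (x + y) = chi x * chi y.
Hypothesis chi_nontriv : exists x, chi x != 1.

Local Notation V := 'rV[F]_d.
Local Notation q := #|F|.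
Local Notation n := #|{: V}|.

Variables (f : V -> F) (w : V -> V).
Hypothesis f_scale : forall (t : F) (a : V), f (t *: a) = t * f a.
Hypothesis w_agree : forall a, f a = dot (w a) a.
Hypothesis w_max : forall a s, f a = dot s a -> (agreement f s <= agreement f (w a))%N.
Hypothesis w_scale : forall t a, t != 0 -> w (t *: a) = w a.

Local Notation J := (agreement_excess f).
Local Notation cls r := (fun a : V => (w a == r)%:R : int).

Lemma card_bad_quadruples :
  q%:Z * \sum_a \sum_b \sum_c
    (w a != w b)%:R * (f a + f b - f c - f (a + b - c) == 0)%:R <= 9 * n%:Z ^+ 3.
Proof.
set Bad := \sum_a _.
have cls_inv r : scale_invariant (cls r) by move=> t a t0; rewrite w_scale.
pose kap a b c : int := q%:Z * (f a + f b - f c - f (a + b - c) == 0) - 1.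
have n0 : 0 < n%:Z by rewrite ltz_nat; apply/card_gt0P; exists 0.
have q1 : 1 < q%:Z := card_finNzRing_gt1 F.
(* Subtracting the fourth-moment identities of the classes from that of the whole function cancels
   the pairs with [w a = w b]. *)
have quadE : \sum_s J (fun=> 1) s ^+ 2 *
      (J (fun=> 1) s ^+ 2 - \sum_r J (cls r) s ^+ 2) =
    (q%:Z - 1) ^+ 3 * n%:Z * \sum_a \sum_b \sum_c (w a != w b)%:R * kap a b c.
  transitivity (\sum_s J (fun=> 1) s * J (fun=> 1) s * J (fun=> 1) s ^+ 2 -
      \sum_r \sum_s J (cls r) s * J (cls r) s * J (fun=> 1) s ^+ 2).
    rewrite exchange_big -sumrB; apply: eq_bigr => s _ /=.
    rewrite mulrBr -expr2; congr (_ - _); rewrite mulr_sumr.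
    by apply: eq_bigr => r _; ring.
  rewrite (sum_agreement_excess_quad chi0 chiD chi_nontriv f_scale) //.
  rewrite (eq_bigr _ (fun r _ => sum_agreement_excess_quad chi0 chiD chi_nontriv
    f_scale (cls_inv r) (cls_inv r))).
  rewrite -mulr_sumr -mulrBr; congr (_ * _).
  rewrite [X in _ - X]exchange_big -sumrB; apply: eq_bigr => a _ /=.
  rewrite [X in _ - X]exchange_big -sumrB; apply: eq_bigr => b _ /=.
  rewrite [X in _ - X]exchange_big -sumrB; apply: eq_bigr => c _ /=.
  rewrite -mulr_suml -mulrBl; congr (_ * _).
  rewrite (bigD1 (w a)) //= big1 => [|r /negPf ar]; last first.
    by rewrite [w a == r]eq_sym ar mul0r.
  by rewrite eqxx eq_sym; case: (w a == w b).
have up : \sum_s J (fun=> 1) s ^+ 2 *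
      (J (fun=> 1) s ^+ 2 - \sum_r J (cls r) s ^+ 2) <=
    4 * n%:Z ^+ 2 * q%:Z * ((q%:Z - 1) ^+ 2 * n%:Z ^+ 2).
  rewrite -(sum_agreement_excess_sqr chi0 chiD chi_nontriv f_scale) mulr_sumr.
  apply: ler_sum => s _; rewrite [leRHS]mulrC; apply: ler_wpM2l; first exact: sqr_ge0.
  apply: le_trans (agreement_excess_sqr_drop w_agree w_max s).
  by rewrite lerD2l lerN2 (bigD1 s) //= lerDl sumr_ge0 // => r _; exact: sqr_ge0.
(* The summand -1 of [kap] costs at most 1 per triple. *)
have lo : q%:Z * Bad - n%:Z ^+ 3 <= \sum_a \sum_b \sum_c (w a != w b)%:R * kap a b c.
  have -> : n%:Z ^+ 3 = \sum_(a : V) \sum_(b : V) \sum_(c : V) 1.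
    by rewrite !sumr_const -!mulrnA natz !PoszM; ring.
  rewrite mulr_sumr -sumrB; apply: ler_sum => a _.
  rewrite mulr_sumr -sumrB; apply: ler_sum => b _.
  rewrite mulr_sumr -sumrB; apply: ler_sum => c _.
  by rewrite /kap; case: (w a != w b); case: (_ == 0) => /=; lia.
rewrite quadE in up.
set T := \sum_a _ in up lo.
have qT : (q%:Z - 1) * T <= 4 * n%:Z ^+ 3 * q%:Z.
  have p0 : 0 < (q%:Z - 1) ^+ 2 * n%:Z by rewrite mulr_gt0 // exprn_gt0 // subr_gt0.
  rewrite -(ler_pM2l p0); lra.
have q10 : 0 < q%:Z - 1 by rewrite subr_gt0.
rewrite -(ler_pM2l q10).
have : (q%:Z - 1) * (q%:Z * Bad - n%:Z ^+ 3) <= 4 * n%:Z ^+ 3 * q%:Z.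
  by apply: le_trans qT; rewrite ler_pM2l.
(* Since [q <= 2 (q - 1)], the bound 4 becomes 8 after division by [q - 1]; the term [n^3] from [lo]
   makes it 9. *)
have : n%:Z ^+ 3 * q%:Z <= n%:Z ^+ 3 * (2 * (q%:Z - 1)).
  by rewrite ler_pM2l ?exprn_gt0 //; lia.
rewrite mulrBr; move: (n%:Z ^+ 3) (q%:Z * Bad) => N B; lia.
Qed.

End BadQuadruples.

(** * Choice of [w], a character of the prime field, and the four-term test *)

Lemma exists_heaviest_explanation (F : finFieldType) (d : nat) (f : 'rV[F]_d -> F) :
  (forall (t : F) a, f (t *: a) = t * f a) ->
  exists w : 'rV[F]_d -> 'rV[F]_d,
    [/\ forall a, f a = dot (w a) a,
        forall a s, f a = dot s a -> (agreement f s <= agreement f (w a))%N &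
        forall t a, t != 0 -> w (t *: a) = w a].
Proof.
move=> f_scale.
pose E a := [set s | f a == dot s a].
(* Choosing from the set [E a], not from [a], makes [w] scale invariant, since [E (t *: a) = E a].
   The default 0 is never reached, as no [E a] is empty. *)
pose best (S : {set 'rV[F]_d}) :=
  if [pick s0 in S] is Some s0 then [arg max_(s > s0 in S) agreement f s] else 0.
have bestP (S : {set 'rV[F]_d}) s : s \in S ->
    best S \in S /\ (agreement f s <= agreement f (best S))%N.
  rewrite /best; case: pickP => [s0 s0S sS|->//].
  by case: arg_maxnP => // r rS rmax; split=> //; apply: rmax.
have E_nonempty a : exists s, s \in E a.
  have [->|a0] := eqVneq a 0.
    by exists 0; rewrite inE dot0r -(scale0r 0) f_scale mul0r.
  by have [s sa] := dot_surj (f a) a0; exists s; rewrite inE sa.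
exists (best \o E); split => [a|a s fs|t a t0] /=.
- have [s /bestP[]] := E_nonempty a.
  by rewrite inE => /eqP.
- by apply: (bestP (E a) s _).2; rewrite inE fs.
- congr best; apply/setP => s.
  by rewrite !inE f_scale dotZr (inj_eq (mulfI t0)).
Qed.

Lemma Fp_character (p : nat) : prime p -> exists chi : 'F_p -> algC,
  [/\ chi 0 = 1, forall x y, chi (x + y) = chi x * chi y & exists x, chi x != 1].
Proof.
move=> p_pr; have [z z_prim] := C_prim_root_exists (prime_gt0 p_pr).
exists (fun x => z ^+ (x : nat)); split => [|x y|].
- by rewrite expr0.
- rewrite -exprD -(prim_expr_mod z_prim (_ + _)); congr (z ^+ _).
  exact: (congr1 (modn _) (Fp_cast p_pr)).
- exists 1; apply/eqP => /esym/eqP; rewrite -(expr0 z) (eq_prim_root_expr z_prim).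
  by rewrite /= Fp_cast // mod0n !modn_small ?prime_gt1.
Qed.

(** Two accepted pairs [(a, s - a)] and [(c, s - c)] with the same sum [s] have equal sums of
    values, both being [f s]. Cauchy-Schwarz over [s] then counts such couples. *)
Lemma four_term_test (K : realDomainType) (G : finZmodType) (H : zmodType)
    (f : G -> H) :
  (\sum_a \sum_b (f a + f b == f (a + b))%:R) ^+ 2 <=
  #|G|%:R * \sum_a \sum_b \sum_c (f a + f b == f c + f (a + b - c))%:R :> K.
Proof.
pose m s : K := \sum_a (f a + f (s - a) == f s)%:R.
have -> : \sum_a \sum_b (f a + f b == f (a + b))%:R = \sum_s m s :> K.
  rewrite [RHS]exchange_big; apply: eq_bigr => a _ /=.
  rewrite [RHS](reindex_inj (addrI a)); apply: eq_bigr => b _.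
  by rewrite /= [a + b]addrC addrK.
apply: le_trans (sqr_sum_le _) _; rewrite ler_wpM2l //.
have -> : \sum_a \sum_b \sum_c (f a + f b == f c + f (a + b - c))%:R =
    \sum_s \sum_a \sum_c (f a + f (s - a) == f c + f (s - c))%:R :> K.
  rewrite [RHS]exchange_big; apply: eq_bigr => a _ /=.
  rewrite [RHS](reindex_inj (addrI a)); apply: eq_bigr => b _.
  by rewrite /= [a + b]addrC addrK.
apply: ler_sum => s _; rewrite expr2 big_distrlr /=.
apply: ler_sum => a _; apply: ler_sum => c _.
case: eqP => [->|_]; last by rewrite mul0r ler0n.
by rewrite mul1r eq_sym.
Qed.

(** Acceptance of the vector-valued test implies acceptance in coordinate [i], so the scalar bound
    applies. *)
Lemma explanation_rarely_splits (p d l : nat) (f : 'rV['F_p]_d -> 'rV['F_p]_l)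
    (i : 'I_l) :
  prime p -> scalar_respecting f ->
  exists w : 'rV['F_p]_d -> 'rV['F_p]_d,
    (forall a, f a ord0 i = dot (w a) a) /\
    p%:Z * \sum_a \sum_b \sum_c (w a != w b)%:R *
        (f a + f b == f c + f (a + b - c))%:R <= 9 * #|{: 'rV['F_p]_d}|%:Z ^+ 3.
Proof.
move=> p_pr f_scale.
pose fi a := f a ord0 i.
have fi_scale (t : 'F_p) a : fi (t *: a) = t * fi a by rewrite /fi f_scale mxE.
have [w [w_agree w_max w_scale]] := exists_heaviest_explanation fi_scale.
have [chi [chi0 chiD chi_nontriv]] := Fp_character p_pr.
exists w; split=> //.
apply: le_trans
  (card_bad_quadruples chi0 chiD chi_nontriv fi_scale w_agree w_max w_scale).
rewrite card_Fp // ler_wpM2l //.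
apply: ler_sum => a _; apply: ler_sum => b _; apply: ler_sum => c _.
rewrite ler_wpM2l ?ler0n //; case: eqP => [/rowP/(_ i)|_]; rewrite ?ler0n //.
by rewrite !mxE /fi => ->; rewrite -addrA -opprD subrr eqxx.
Qed.

(** * From the coordinates to one linear function *)

Theorem theorem3p2 (R : realType) :
  exists2 C : R, 0 < C &
    forall (q d l : nat) (f : 'rV['F_q]_d -> 'rV['F_q]_l) (eps kappa : R),
      prime q ->
      scalar_respecting f ->
      0 < eps -> 0 < kappa ->
      eps <= kappa ->
      C / (q%:R `^ (1 / 3)) <= eps ->
      test_pass_pr R f = eps ->
      exists2 c : 'rV['F_q]_d -> 'rV['F_q]_l,
        linear_function c &
        eps ^+ 2 / 3 <=
          unif_pr R (test_var f)
            (fun a => rel_hamming R (f a) (c a) <= kappa).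
Proof.
(* Cubing the lower bound on [eps] gives [eps^3 q >= 27], so the Markov loss [9 / (q kappa)] is at
   most [eps^2 / 3]. *)
exists 3; first by [].
move=> q d l f eps kappa q_pr f_scale eps0 kappa0 epsk Ceps pass.
pose V := 'rV['F_q]_d; pose n : R := #|{: V}|%:R.
have n0 : 0 < n by rewrite ltr0n; apply/card_gt0P; exists 0.
have q0 : 0 < q%:R :> R by rewrite ltr0n prime_gt0.
have eps3 : 27 <= eps ^+ 3 * q%:R.
  have r0 : 0 < q%:R `^ (1 / 3) :> R by rewrite powR_gt0.
  have r3 : (q%:R `^ (1 / 3)) ^+ 3 = q%:R :> R.
    by rewrite -powR_mulrn ?ltW // -powRrM divfK ?pnatr_eq0 // powRr1 // ltW.
  rewrite ler_pdivrMr // in Ceps.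
  have -> : 27 = 3 ^+ 3 :> R by ring.
  by rewrite -r3 -exprMn ler_pXn2r ?nnegrE // mulr_ge0 // ltW.
have [w wP] :=
  fin_all_exists (fun i => explanation_rarely_splits i q_pr f_scale).
pose acc a b c : R := (f a + f b == f c + f (a + b - c))%:R.
have acc_ge : eps ^+ 2 * n ^+ 3 <= \sum_a \sum_b \sum_c acc a b c.
  have passE : \sum_a \sum_b (f a + f b == f (a + b))%:R = eps * n ^+ 2 :> R.
    rewrite -pass /test_pass_pr /unif_pr cardsT card_prod natrM -expr2 divfK.
      rewrite pair_bigA -sum1dep_card natr_sum [RHS]big_mkcond /=.
      by apply: eq_bigr => x _; rewrite inE /test_accepts; case: (_ == _).
    by rewrite expf_neq0 // gt_eqF.
  have := four_term_test R f; rewrite passE -/n => H.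
  rewrite -(ler_pM2l n0); apply: le_trans H; rewrite le_eqVlt; apply/orP; left.
  by apply/eqP; ring.
(* For [l = 0] this is 0, as is [rel_hamming]. *)
pose split_frac a b : R := (\sum_i (w i a != w i b)%:R) / l%:R.
have split0 a b : 0 <= split_frac a b by rewrite divr_ge0 ?ler0n ?sumr_ge0.
have acc_split : \sum_a \sum_b \sum_c acc a b c * split_frac a b <= 9 * n ^+ 3 / q%:R.
  have bad_i i : \sum_a \sum_b \sum_c acc a b c * (w i a != w i b)%:R <=
      9 * n ^+ 3 / q%:R.
    have := (wP i).2; rewrite -(ler_int R) 2!rmorphM rmorphXn /= ler_pdivlMr // => H.
    rewrite mulrC; apply: le_trans H; rewrite ler_pM2l // raddf_sum.
    apply: ler_sum => a _; rewrite raddf_sum; apply: ler_sum => b _.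
    rewrite raddf_sum; apply: ler_sum => c _.
    by rewrite /acc /= rmorphM /= mulrC; do 2!case: (_ == _).
  have -> : \sum_a \sum_b \sum_c acc a b c * split_frac a b =
      \sum_i (\sum_a \sum_b \sum_c acc a b c * (w i a != w i b)%:R) / l%:R.
    rewrite -mulr_suml [in RHS]exchange_big mulr_suml; apply: eq_bigr => a _ /=.
    rewrite [in RHS]exchange_big mulr_suml; apply: eq_bigr => b _ /=.
    rewrite [in RHS]exchange_big mulr_suml; apply: eq_bigr => c _ /=.
    by rewrite /split_frac mulrA mulr_sumr.
  apply: le_trans (_ : \sum_(i < l) (9 * n ^+ 3 / q%:R) / l%:R <= _).
    by apply: ler_sum => i _; rewrite ler_wpM2r ?invr_ge0 ?ler0n.
  rewrite sumr_const card_ord -[leLHS]mulr_natr -[leLHS]mulrA ler_piMr //.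
    by rewrite divr_ge0 ?mulr_ge0 ?exprn_ge0 // ltW.
  by have [->|l0] := eqVneq (l%:R : R) 0; rewrite ?mulr0 // mulVf.
pose good a b : R := (split_frac a b <= kappa)%R%:R.
have good_ge : eps ^+ 2 / 3 * n ^+ 3 < \sum_a \sum_b \sum_c acc a b c * good a b.
  (* Markov, pointwise: a pair that is not good has [split_frac a b / kappa >= 1]. *)
  have markov a b c : acc a b c - kappa^-1 * (acc a b c * split_frac a b) <=
      acc a b c * good a b.
    rewrite mulrCA -{1}[acc a b c]mulr1 -mulrBr ler_wpM2l ?ler0n // /good.
    have [_|/ltW split_ge] := leP (split_frac a b) kappa.
      by rewrite gerBl mulr_ge0 ?invr_ge0 // ltW.
    by rewrite subr_le0 mulrC ler_pdivlMr ?mul1r.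
  have : \sum_a \sum_b \sum_c acc a b c -
      kappa^-1 * \sum_a \sum_b \sum_c acc a b c * split_frac a b <=
      \sum_a \sum_b \sum_c acc a b c * good a b.
    rewrite mulr_sumr -sumrB; apply: ler_sum => a _.
    rewrite mulr_sumr -sumrB; apply: ler_sum => b _.
    rewrite mulr_sumr -sumrB; apply: ler_sum => c _; exact: markov.
  apply: lt_le_trans.
  apply: lt_le_trans (lerB acc_ge (ler_wpM2l _ acc_split)); last first.
    by rewrite invr_ge0 ltW.
  have -> : kappa^-1 * (9 * n ^+ 3 / q%:R) = 9 / (q%:R * kappa) * n ^+ 3.
    by field; rewrite !gt_eqF.
  rewrite -mulrBl ltr_pM2r ?exprn_gt0 // ltrBrDr -ltrBrDl ltr_pdivrMr ?mulr_gt0 //.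
  have : eps ^+ 3 * q%:R <= eps ^+ 2 * (q%:R * kappa).
    have -> : eps ^+ 3 * q%:R = eps ^+ 2 * q%:R * eps by ring.
    by rewrite mulrA ler_pM2l // mulr_gt0 ?exprn_gt0.
  by lra.
(* Once acceptance is dropped, [c] is free and contributes a factor [n]; averaging over [a] then
   yields a good one. *)
have [a a_good] : exists a : V, eps ^+ 2 / 3 * n <= \sum_b good a b.
  apply/existsP; apply: contraLR good_ge; rewrite negb_exists -leNgt => /forallP few.
  apply: le_trans (_ : \sum_(a : V) \sum_(b : V) \sum_(c : V) good a b <= _).
    apply: ler_sum => a _; apply: ler_sum => b _; apply: ler_sum => c _.
    by rewrite /acc; case: (_ == _); rewrite ?mul1r ?mul0r ?ler0n.
  apply: le_trans (_ : \sum_(a : V) n * (eps ^+ 2 / 3 * n) <= _).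
    apply: ler_sum => a _; under eq_bigr => b _ do rewrite sumr_const -mulr_natl.
    by rewrite -mulr_sumr ler_pM2l //; have := few a; rewrite -ltNge => /ltW.
  by rewrite sumr_const -mulr_natl -/n le_eqVlt; apply/orP; left; apply/eqP; ring.
exists (fun x => \row_i dot (w i a) x).
  by move=> x y; apply/rowP => i; rewrite !mxE dotDr.
have -> : test_var f = setT.
  apply/setP => x; rewrite !inE; apply/existsP; exists 0.
  by rewrite inE /test_accepts /= addr0 -(scale0r 0) f_scale scale0r addr0.
rewrite /unif_pr cardsT ler_pdivlMr //; apply: le_trans a_good _.
rewrite -sum1dep_card natr_sum [leRHS]big_mkcond; apply: ler_sum => b _.
rewrite /good; case: (boolP (split_frac a b <= kappa)) => [good_ab|_]; last first.
  by case: ifP; rewrite ?ler0n.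
rewrite inE /=; suff -> : rel_hamming R (f b) (\row_i dot (w i a) b) <= kappa by [].
(* Coordinate [i] of [f b] is [dot (w i b) b], so it can differ from that of the linear function
   only if [w i a != w i b]. *)
apply: le_trans good_ab; rewrite /rel_hamming /unif_pr cardsT card_ord.
rewrite ler_wpM2r ?invr_ge0 ?ler0n // -sum1dep_card natr_sum big_mkcond.
apply: ler_sum => i _; rewrite inE mxE /= (wP i).1.
by case: (eqVneq (w i a) (w i b)) => [->|_]; rewrite ?eqxx //; case: ifP.
Qed.
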